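(* Let $(V;\rho^L,\rho^R)$ be a representation of a Leibniz algebra $(\mathfrak g,[\cdot,\cdot]_{\mathfrak g})$, let $\Omega$ be the Leibniz bracket of the semidirect product $\mathfrak g\ltimes_{\rho^L,\rho^R}V$, and let $H:V\to\mathfrak g$ be a linear map. The twisting $((\mathfrak g\oplus V,\Omega^H),\mathfrak g,V)$ is a twilled Leibniz algebra if and only if $H$ is a relative Rota–Baxter operator on $(\mathfrak g,[\cdot,\cdot]_{\mathfrak g})$ with respect to the representation $(V;\rho^L,\rho^R)$. Moreover, in this case the Leibniz algebra structure on $V$ (as a subalgebra of $(\mathfrak g\oplus V,\Omega^H)$) is given by $$[u,v]_H=\rho^L(H(u))v+\rho^R(H(v))u,\qquad\forall u,v\in V.$$
   Context: All vector spaces are finite-dimensional over an algebraically closed field $\mathbb K$ of characteristic $0$. A Leibniz algebra is a vector space with a bilinear operation satisfying $[x,[y,z]]=[[x,y],z]+[y,[x,z]]$. A representation of a Leibniz algebra $\mathfrak g$ is $(V;\rho^L,\rho^R)$ with linear maps $\rho^L,\rho^R:\mathfrak g\to\mathfrak{gl}(V)$ such that $\rho^L([x,y])=[\rho^L(x),\rho^L(y)]$, $\rho^R([x,y])=[\rho^L(x),\rho^R(y)]$, $\rho^R(y)\rho^L(x)=-\rho^R(y)\rho^R(x)$. The semidirect product $\mathfrak g\ltimes_{\rho^L,\rho^R}V$ is $\mathfrak g\oplus V$ with bracket $\Omega(x+u,y+v)=[x,y]_{\mathfrak g}+\rho^L(x)v+\rho^R(y)u$. A relative Rota–Baxter operator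 on $\mathfrak g$ with respect to $(V;\rho^L,\rho^R)$ is a linear map $K:V\to\mathfrak g$ with $[Kv_1,Kv_2]_{\mathfrak g}=K(\rho^L(Kv_1)v_2+\rho^R(Kv_2)v_1)$ for all $v_1,v_2\in V$. A twilled Leibniz algebra is a triple $(\mathcal G,\mathfrak g_1,\mathfrak g_2)$ where $\mathcal G$ is a Leibniz algebra, $\mathcal G=\mathfrak g_1\oplus\mathfrak g_2$ as vector spaces, and $\mathfrak g_1,\mathfrak g_2$ are subalgebras. Twisting: the lift of $H$ is $\hat H:\mathfrak g\oplus V\to\mathfrak g\oplus V$, $\hat H(x,v)=(H(v),0)$. For a bilinear map $B$ on $\mathfrak g\oplus V$, $[B,\hat H]_{\mathsf B}(X,Y)=B(\hat HX,Y)+B(X,\hat HY)-\hat H(B(X,Y))$. The twisting of $\Omega$ by $H$ is $\Omega^H=e^{[\cdot,\hat H]_{\mathsf B}}\Omega=\sum_{n\ge0}\frac1{n!}[\cdots[[\Omega,\hat H]_{\mathsf B},\hat H]_{\mathsf B},\cdots,\hat H]_{\mathsf B}$ ($n$ brackets), a finite sum. *)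

(* Defs.v *)
From HB Require Import structures.
From mathcomp Require Import all_boot all_order all_algebra.
From mathcomp Require Import boolp classical_sets functions cardinality fsbigop.

Set Implicit Arguments.
Unset Strict Implicit.
Unset Printing Implicit Defensive.

Import GRing.Theory.

Local Open Scope ring_scope.

Section LeibnizAlgebras.
Variable K : fieldType.

Definition is_bilinear (G : lmodType K) (f : G -> G -> G) : Prop :=
  bilinear_for *:%R *:%R f.

(* Left Leibniz algebras: every [f x] is a derivation of [f]. *)
Definition leibniz_bracket (G : lmodType K) (f : G -> G -> G) : Prop :=
  is_bilinear f /\
  forall x y z, f x (f y z) = f (f x y) z + f y (f x z).

Definition gl_bracket (V : vectType K) (a b : 'End(V)) : 'End(V) :=
  (a \o b)%VF - (b \o a)%VF.

Definition leibniz_rep (g V : vectType K) (br : g -> g -> g)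
    (rhoL rhoR : {linear g -> 'End(V)}) : Prop :=
  [/\ forall x y, rhoL (br x y) = gl_bracket (rhoL x) (rhoL y),
      forall x y, rhoR (br x y) = gl_bracket (rhoL x) (rhoR y)
    & forall x y, (rhoR y \o rhoL x)%VF = - (rhoR y \o rhoR x)%VF].

Definition semidirect_bracket (g V : vectType K) (br : g -> g -> g)
    (rhoL rhoR : {linear g -> 'End(V)}) (X Y : g * V) : g * V :=
  (br X.1 Y.1, rhoL X.1 Y.2 + rhoR Y.1 X.2).

Definition relative_rota_baxter (g V : vectType K) (br : g -> g -> g)
    (rhoL rhoR : {linear g -> 'End(V)}) (T : {linear V -> g}) : Prop :=
  forall v1 v2, br (T v1) (T v2) = T (rhoL (T v1) v2 + rhoR (T v2) v1).

Definition subalgebra (G : vectType K) (f : G -> G -> G) (U : {vspace G}) :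
    Prop :=
  forall x y, x \in U -> y \in U -> f x y \in U.

Definition twilled (G : vectType K) (f : G -> G -> G) (G1 G2 : {vspace G}) :
    Prop :=
  [/\ leibniz_bracket f, (G1 + G2)%VS = fullv, directv (G1 + G2),
      subalgebra f G1 & subalgebra f G2].

Definition inl_space (g V : vectType K) : {vspace g * V} :=
  limg (linfun (fun x : g => (x, 0) : g * V)).

Definition inr_space (g V : vectType K) : {vspace g * V} :=
  limg (linfun (fun v : V => (0, v) : g * V)).

(* [linfun] is meaningful only on linear functions, hence this check. *)
Lemma mem_inl_space (g V : vectType K) (X : g * V) :
  (X \in inl_space g V) = (X.2 == 0).
Proof.
have lin_inl : linear (fun x : g => (x, 0) : g * V).
  by move=> a x y; congr pair; rewrite /= scaler0 addr0.
pose inlM := GRing.isLinear.Build _ _ _ _ _ lin_inl.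
pose f : {linear g -> (g * V)%type} := HB.pack (fun x : g => (x, 0) : g * V) inlM.
apply/memv_imgP/eqP => [[x _ ->] | X20]; first by rewrite (lfunE f).
by exists X.1; rewrite ?memvf // (lfunE f) /= -X20; case: X {X20}.
Qed.

Lemma mem_inr_space (g V : vectType K) (X : g * V) :
  (X \in inr_space g V) = (X.1 == 0).
Proof.
have lin_inr : linear (fun v : V => (0, v) : g * V).
  by move=> a x y; congr pair; rewrite /= scaler0 addr0.
pose inrM := GRing.isLinear.Build _ _ _ _ _ lin_inr.
pose f : {linear V -> (g * V)%type} := HB.pack (fun v : V => (0, v) : g * V) inrM.
apply/memv_imgP/eqP => [[x _ ->] | X10]; first by rewrite (lfunE f).
by exists X.2; rewrite ?memvf // (lfunE f) /= -X10; case: X {X10}.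
Qed.

Definition hat_map (g V : vectType K) (H : {linear V -> g}) (X : g * V) : g * V :=
  (H X.2, 0).

Definition bracketB (G : lmodType K) (B : G -> G -> G) (h : G -> G) :
    G -> G -> G :=
  fun X Y => B (h X) Y + B X (h Y) - h (B X Y).

(* The sum is taken in the K-vector space of functions G -> G -> G and ranges
   over all natural numbers; a sum with infinite support would be 0, but the
   support is finite by [iter_bracketB_eq0]. *)
Definition twisting (g V : vectType K) (B : g * V -> g * V -> g * V)
    (H : {linear V -> g}) : g * V -> g * V -> g * V :=
  \sum_(n \in [set: nat])
    (n`!%:R : K)^-1 *: iter n (fun C => bracketB C (hat_map H)) B.

Lemma iter_bracketB_eq0 (g V : vectType K) (B : g * V -> g * V -> g * V)
    (H : {linear V -> g}) (n : nat) :
  is_bilinear B -> (3 < n)%N ->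
  iter n (fun C => bracketB C (hat_map H)) B = 0.
Proof.
move=> [Bl Br] n_gt3; set h := hat_map H; set P := fun C => bracketB C h.
have hD X Y : h (X + Y) = h X + h Y.
  by rewrite /h /hat_map /= linearD; congr pair; rewrite addr0.
have hN X : h (- X) = - h X.
  by rewrite /h /hat_map /= linearN; congr pair; rewrite oppr0.
have hh X : h (h X) = 0 by rewrite /h /hat_map /= linear0.
have h0 : h 0 = 0 by rewrite /h /hat_map /= linear0.
have B0l Y : B 0 Y = 0.
  by have := Bl Y 1 0 0; rewrite /= !scale1r addr0 => /eqP;
    rewrite -subr_eq subrr eq_sym => /eqP.
have B0r X : B X 0 = 0.
  by have := Br X 1 0 0; rewrite /= !scale1r addr0 => /eqP;
    rewrite -subr_eq subrr eq_sym => /eqP.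
have P0 : P 0 = 0.
  apply/funext => X; apply/funext => Y; rewrite /P /bracketB.
  have z A C : (0 : g * V -> g * V -> g * V) A C = 0 by [].
  by rewrite !z h0 subr0 addr0.
have P4 : iter 4 P B = 0.
  apply/funext => X; apply/funext => Y.
  change (iter 4 P B X Y = 0).
  by rewrite /= /P /bracketB !(hh, B0l, B0r, hD, hN, h0, oppr0, addr0, add0r,
    subr0, sub0r, opprD, opprK) ?subrr ?addr0 ?subrr.
rewrite -(subnK n_gt3) iterD P4.
by elim: (n - 4)%N => //= m ->.
Qed.

End LeibnizAlgebras.

(* Main.v *)
(* Since hat_map H squares to zero, E = 1 + hat_map H is invertible with inverse
   1 - hat_map H, and the exponential series collapses to
   Omega^H (X, Y) = E^-1 Omega (E X, E Y).  So Omega^H is isomorphic to the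
   semidirect product and is always a Leibniz bracket, and the summand g is
   always a subalgebra.  The g-component of Omega^H ((0, u), (0, v)) is the
   defect of the relative Rota-Baxter identity at (u, v), so V is a subalgebra
   exactly when that identity holds. *)
Require Import Defs.
From HB Require Import structures.
From mathcomp Require Import all_boot all_order all_algebra.
From mathcomp Require Import boolp classical_sets functions fsbigop.

Set Implicit Arguments.
Unset Strict Implicit.
Unset Printing Implicit Defensive.

Import GRing.Theory.

Local Open Scope ring_scope.

Section Bilinear.
Variables (K : fieldType) (G : lmodType K) (f : G -> G -> G).
Hypothesis f_bil : is_bilinear f.

Lemma bilinearDl x y z : f (x + y) z = f x z + f y z.
Proof. by have := f_bil.1 z 1 x y; rewrite /= !scale1r. Qed.

Lemma bilinearDr x y z : f x (y + z) = f x y + f x z.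
Proof. by have := f_bil.2 x 1 y z; rewrite /= !scale1r. Qed.

Lemma bilinear0l z : f 0 z = 0.
Proof. by apply: (addrI (f 0 z)); rewrite -bilinearDl !addr0. Qed.

Lemma bilinear0r x : f x 0 = 0.
Proof. by apply: (addrI (f x 0)); rewrite -bilinearDr !addr0. Qed.

Lemma bilinear_conj (E F : {linear G -> G}) :
  is_bilinear (fun x y => F (f (E x) (E y))).
Proof.
by split=> [z a x y | z a x y]; rewrite linearP ?(f_bil.1 (E z)) ?(f_bil.2 (E z))
  linearP.
Qed.

End Bilinear.

(** In a nested bracket the inner [F] cancels against the [E] around it, so the identity is the
    image under [F] of that of [f] at [E x], [E y], [E z]. *)
Lemma leibniz_conj (K : fieldType) (G : lmodType K) (f : G -> G -> G)
    (E F : {linear G -> G}) :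
  leibniz_bracket f -> cancel F E ->
  leibniz_bracket (fun x y => F (f (E x) (E y))).
Proof.
move=> [f_bil f_leib] FK; split; first exact: bilinear_conj.
by move=> x y z; rewrite !FK f_leib linearD.
Qed.

Lemma leibniz_semidirect (K : fieldType) (g V : vectType K) (br : g -> g -> g)
    (rhoL rhoR : {linear g -> 'End(V)}) :
  leibniz_bracket br -> leibniz_rep br rhoL rhoR ->
  leibniz_bracket (semidirect_bracket br rhoL rhoR).
Proof.
move=> [br_bil br_leib] [repL repR repRL]; split.
  split=> [[z w] a [x u] [y v] | [z w] a [x u] [y v]]; congr pair => /=.
  - exact: br_bil.1.
  - by rewrite !linearP /= add_lfunE scale_lfunE scalerDr addrACA.
  - exact: br_bil.2.
  - by rewrite !linearP /= add_lfunE scale_lfunE scalerDr addrACA.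
move=> [x u] [y v] [z w]; congr pair; first exact: br_leib.
rewrite /= repL !repR /gl_bracket !add_lfunE !opp_lfunE !comp_lfunE !linearD /=.
(* The third representation axiom enters only through the terms in [u]; the terms in [v] and [w]
   cancel by the two commutator formulas. *)
have -> : rhoR z (rhoL y u) = - rhoR z (rhoR y u).
  by have := congr1 (fun a : 'End(V) => a u) (repRL y z);
    rewrite opp_lfunE !comp_lfunE.
rewrite opprK [RHS](AC (2*2*(2*2)) ((1*7*(6*4))*(2*5)*(3*8))) /=.
by rewrite addNr subrr !addr0.
Qed.

Section Twisting.
Variables (K : fieldType) (g V : vectType K) (H : {linear V -> g}).

Lemma hat_map_is_linear : linear (hat_map H).
Proof.
move=> a X Y; rewrite /hat_map /= linearP; congr pair.
by rewrite /= scaler0 addr0.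
Qed.

HB.instance Definition _ :=
  GRing.isLinear.Build K (g * V)%type (g * V)%type _ (hat_map H)
    hat_map_is_linear.

Lemma hat_map_hat_map X : hat_map H (hat_map H X) = 0.
Proof. by rewrite /hat_map /= linear0. Qed.

Section Series.
Variable (B : g * V -> g * V -> g * V).
Hypothesis B_bil : is_bilinear B.
Local Notation h := (hat_map H).
Local Notation ad C := (bracketB C h).

(** [ad] is the sum of three commuting operators of square zero: inserting [h] in the left argument,
    in the right one, and composing with [- h] on the outside. Its square is twice the sum of their
    pairwise products. *)
Lemma bracketB_hat2 X Y :
  ad (ad B) X Y = (B (h X) (h Y) - h (B (h X) Y) - h (B X (h Y))) *+ 2.
Proof.
rewrite /bracketB !hat_map_hat_map (bilinear0l B_bil) (bilinear0r B_bil).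
rewrite !(raddfB, raddfD) /= hat_map_hat_map !(oppr0, addr0, add0r) mulr2n.
by rewrite (AC (2*2*2) ((1*2*4)*(3*5*6))).
Qed.

(** Only the product of all three operators survives in the cube, with multiplicity 3!. *)
Lemma bracketB_hat3 X Y : ad (ad (ad B)) X Y = - h (B (h X) (h Y)) *+ 6.
Proof.
(* Only the outermost bracket is unfolded, so that the formula for the square applies to what
   remains. *)
rewrite [LHS](_ : _ =
  ad (ad B) (h X) Y + ad (ad B) X (h Y) - h (ad (ad B) X Y)) //.
rewrite !bracketB_hat2 !hat_map_hat_map !(bilinear0l B_bil) !(bilinear0r B_bil).
rewrite raddfMn !raddfB /= !hat_map_hat_map raddf0 !(sub0r, oppr0, subr0, addr0).
by rewrite -mulNrn -!mulrnDr.
Qed.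

(** For commuting [a], [b], [c] of square zero, exp(a + b + c) = (1 + a)(1 + b)(1 + c); the inverse
    factorials remove exactly the multiplicities 2 and 6. *)
Lemma twistingE X Y : [pchar K] =i pred0 ->
  twisting B H X Y = (idfun \- h) (B ((idfun \+ h) X) ((idfun \+ h) Y)).
Proof.
move=> /pcharf0P charK.
have scalerVMn n (v : g * V) : (n.+1%:R : K)^-1 *: (v *+ n.+1) = v.
  by rewrite -scaler_nat scalerA mulVf ?scale1r ?charK.
rewrite /twisting -(fsbig_widen `I_4) /=; last 2 first.
- by [].
- move=> n [_ /negP]; rewrite -leqNgt => ?.
  by rewrite /= iter_bracketB_eq0 ?scaler0.
rewrite -fsbig_ord !big_ord_recr big_ord0 /= add0r.
rewrite !addrfctE !scalrfctE.
rewrite bracketB_hat2 bracketB_hat3 !invr1 !scale1r !scalerVMn.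
rewrite [ad B X Y](_ : _ = B (h X) Y + B X (h Y) - h (B X Y)) //.
rewrite !(bilinearDl B_bil) !(bilinearDr B_bil) !(raddfD h) /= !opprD.
by rewrite [LHS](AC (1*3*3*1) ((1*3*(2*5))*(4*7*(6*8)))).
Qed.
End Series.
End Twisting.

(** The two factors always decompose [g * V], and a factor is closed when the other coordinate of
    its brackets vanishes. *)
Lemma twilled_inl_inrP (K : fieldType) (g V : vectType K)
  (f : g * V -> g * V -> g * V) :
  twilled f (inl_space g V) (inr_space g V) <->
    [/\ leibniz_bracket f, forall x y, (f (x, 0) (y, 0)).2 = 0
      & forall u v, (f (0, u) (0, v)).1 = 0].
Proof.
split=> [[f_leib _ _ f_inl f_inr] | [f_leib f_inl f_inr]].
  split=> // [x y | u v]; apply/eqP.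
    by rewrite -mem_inl_space; apply: f_inl; rewrite mem_inl_space.
  by rewrite -mem_inr_space; apply: f_inr; rewrite mem_inr_space.
split=> //.
- apply/vspaceP => -[x v]; rewrite memvf; apply/memv_addP.
  exists (x, 0); first by rewrite mem_inl_space.
  exists (0, v); first by rewrite mem_inr_space.
  by congr pair; rewrite /= ?addr0 ?add0r.
- apply/directv_addP/vspaceP => -[x v].
  by rewrite memv_cap mem_inl_space mem_inr_space memv0 /= andbC.
- move=> [x u] [y v]; rewrite !mem_inl_space /= => /eqP -> /eqP ->.
  exact/eqP/f_inl.
- move=> [x u] [y v]; rewrite !mem_inr_space /= => /eqP -> /eqP ->.
  exact/eqP/f_inr.
Qed.

Theorem theorem3p20 (K : closedFieldType) (charK : [pchar K] =i pred0)
    (g V : vectType K) (br : g -> g -> g) (hbr : leibniz_bracket br)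
    (rhoL rhoR : {linear g -> 'End(V)}) (hrho : leibniz_rep br rhoL rhoR)
    (H : {linear V -> g}) :
  let Omega := semidirect_bracket br rhoL rhoR in
  let OmegaH := twisting Omega H in
  let brH := fun u v : V => rhoL (H u) v + rhoR (H v) u in
  (twilled OmegaH (inl_space g V) (inr_space g V)
     <-> relative_rota_baxter br rhoL rhoR H) /\
  (relative_rota_baxter br rhoL rhoR H ->
     leibniz_bracket brH /\
     forall u v : V, OmegaH (0, u) (0, v) = (0, brH u v)).
Proof.
move=> Omega OmegaH brH.
have Omega_leib : leibniz_bracket Omega by exact: leibniz_semidirect.
have OmegaHE : OmegaH = fun X Y =>
    (idfun \- hat_map H)
      (Omega ((idfun \+ hat_map H) X) ((idfun \+ hat_map H) Y)).
  apply/funext => X; apply/funext => Y.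
  by apply: twistingE => //; case: Omega_leib.
have OmegaH_leib : leibniz_bracket OmegaH.
  rewrite OmegaHE; apply: leibniz_conj => // X /=.
  by rewrite raddfB /= hat_map_hat_map subr0 subrK.
(* [hat_map H] kills [(x, 0)] and has zero second coordinate, so this reduces to [Omega]. *)
have OmegaH_inl x y : (OmegaH (x, 0) (y, 0)).2 = 0.
  by rewrite OmegaHE /= !linear0 !addr0 !linear0 addr0.
(* [idfun \+ hat_map H] sends [(0, u)] to the point [(H u, u)] of the graph of [H]. *)
have OmegaH_inr u v :
    OmegaH (0, u) (0, v) = (br (H u) (H v) - H (brH u v), brH u v).
  rewrite OmegaHE /Omega /hat_map /semidirect_bracket /=.
  by rewrite !add0r !addr0; congr pair; rewrite /= subr0.
have rbE : relative_rota_baxter br rhoL rhoR H <->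
    forall u v, (OmegaH (0, u) (0, v)).1 = 0.
  split=> rb u v; first by rewrite OmegaH_inr /= rb subrr.
  by apply/eqP; rewrite -subr_eq0; apply/eqP; rewrite -(rb u v) OmegaH_inr.
split; first by rewrite twilled_inl_inrP rbE; split=> [[] | ?].
move=> /rbE OmegaH_sub.
have OmegaH_brH u v : OmegaH (0, u) (0, v) = (0, brH u v).
  by rewrite [LHS]surjective_pairing OmegaH_sub OmegaH_inr.
(* The Leibniz identity of [brH] is the second coordinate of that of [OmegaH] on the summand [V]. *)
split=> //; split; last first.
  move=> u v w; have := OmegaH_leib.2 (0, u) (0, v) (0, w).
  by rewrite !OmegaH_brH => -[].
by split=> [w a u v | w a u v]; rewrite /brH !linearP /= add_lfunE scale_lfunE
  scalerDr addrACA.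
Qed.
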